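(* Let $\mathcal{G}=(\mathcal{V},\mathcal{A})$ be a directed network and $\mathcal{A}_a\subseteq\mathcal{A}$ a set of attackable arcs. If the direction-checking algorithm (described in the context) applied to $(\mathcal{G},\mathcal{A}_a)$ outputs $1$ (respectively $-1$), then for any path $P$ in $\mathcal{G}$ and any two (distinct) arcs $a',a''\in\mathcal{A}_a\cap\mathcal{A}_P$, $a'$ and $a''$ have the same direction (respectively opposite directions) in $P$.
   Context: Let $n_v=|\mathcal{V}|$, $n_a=|\mathcal{A}|$ and let $T\in\{-1,0,1\}^{n_v\times n_a}$ be the incidence matrix ($t_{ij}=-1$, resp. $1$, if node $i$ is the tail, resp. head, of arc $j$; $0$ otherwise). A path $P$ in $\mathcal{G}$ is a sequence of nodes $(v_0,v_1,\dots,v_k)$ with arcs $(a_1,\dots,a_k)$, $k\ge1$, such that $v_0,\dots,v_{k-1}\in\mathcal{V}$ are distinct, $v_k\in\mathcal{V}$ is distinct from $v_0$ if $k\le2$ and is distinct from $v_1,\dots,v_{k-1}$ if $k\ge3$, and for each $i$ either $a_i=(v_{i-1},v_i)\in\mathcal{A}$ or $a_i=(v_i,v_{i-1})\in\mathcal{A}$. $\mathcal{A}_P=\{a_1,\dots,a_k\}$. Two arcs $a_i,a_j$ of $P$, $i\ne j$, have the same direction in $P$ if both agree with the forward order of $P$ or both agree with the reverse order; they have opposite directions in $P$ if one agrees with the forward order and the other with the reverse order. Standing convention: only non-trivial pairs are considered, i.e. no two arcs $a',a''\in\mathcal{A}_a$ are connected directly (sharing a node) or through a single arc. Feasibility system.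 For a pair $a'=(v'_t,v'_h)$, $a''=(v''_t,v''_h)$ of arcs in $\mathcal{A}_a$ (tail, head), let $\mathcal{V}_{\mathrm{inc}}=\{v'_t,v'_h,v''_t,v''_h\}$. For two nodes $v_{i_1},v_{i_2}\in\mathcal{V}_{\mathrm{inc}}$, let $S(v_{i_1},v_{i_2})$ be the linear system in $y\in\mathbb{R}^{n_a}$: $Ty=d$ and $y_j=0$ for every arc $j$ incident to a node of $\mathcal{V}_{\mathrm{inc}}\setminus\{v_{i_1},v_{i_2}\}$, where $d_{i_1}=-1$, $d_{i_2}=1$, and $d_i=0$ otherwise. Direction-checking algorithm. Enumerate the $N=|\mathcal{A}_a|(|\mathcal{A}_a|-1)/2$ pairs of arcs in $\mathcal{A}_a$. Initialize $\chi=0$ and $\eta=\tilde\eta=\eta^+=\eta^-=0\in\mathbb{R}^N$. For the $k$th pair $a',a''$: set $\eta^+_k=1$ if $S(v'_h,v''_t)$ or $S(v''_h,v'_t)$ is feasible; set $\eta^-_k=1$ if $S(v'_h,v''_h)$ or $S(v'_t,v''_t)$ is feasible; set $\eta_k=\eta^+_k-\eta^-_k$ and $\tilde\eta_k=\eta^+_k\eta^-_k$. After all pairs: if $\tilde\eta=0$, then if $\eta\ge0$ set $\chi=1$, and then if $\eta\le0$ set $\chi=-1$. Output $\chi$. *)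

(* Defs.v *)
From mathcomp Require Import all_boot all_order all_algebra.
From mathcomp Require Import boolp reals.

Set Implicit Arguments.
Unset Strict Implicit.
Unset Printing Implicit Defensive.

Import Order.TTheory GRing.Theory Num.Theory.

Local Open Scope ring_scope.

(* A directed network is a finite type V of nodes with a set A : {set V * V}
   of arcs; the arc (u, w) has tail u and head w. *)

Definition tail (V : finType) (a : V * V) : V := a.1.
Definition head (V : finType) (a : V * V) : V := a.2.

Definition ends (V : finType) (a : V * V) : {set V} := [set tail a; head a].

(* Rows and columns follow the enumerations [enum_val] of V and A.  The entry
   is -1 at the tail and 1 at the head; a loop, for which these two clauses
   conflict, gets the zero column. *)
Definition incidence (R : realType) (V : finType) (A : {set V * V}) :
    'M[R]_(#|V|, #|A|) :=
  \matrix_(i, j) ((enum_val i == head (enum_val j))%:R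
                  - (enum_val i == tail (enum_val j))%:R).

(* A path has nodes v 0, ..., v k; its arcs are numbered from 0, so that the
   arc a i joins v i (its [from]) and v (i + 1) (its [to]). *)

Definition from (k : nat) (i : 'I_k) : 'I_k.+1 := widen_ord (leqnSn k) i.
Definition to (k : nat) (i : 'I_k) : 'I_k.+1 := lift ord0 i.

Definition agrees_forward (V : finType) (k : nat)
    (v : 'I_k.+1 -> V) (a : 'I_k -> V * V) (i : 'I_k) : Prop :=
  a i = (v (from i), v (to i)).

Definition agrees_reverse (V : finType) (k : nat)
    (v : 'I_k.+1 -> V) (a : 'I_k -> V * V) (i : 'I_k) : Prop :=
  a i = (v (to i), v (from i)).

(* The last node may coincide with the first one when k >= 3. *)
Definition is_path (V : finType) (A : {set V * V}) (k : nat)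
    (v : 'I_k.+1 -> V) (a : 'I_k -> V * V) : Prop :=
  [/\ (1 <= k)%N,
      forall i j : 'I_k.+1, (i < k)%N -> (j < k)%N -> v i = v j -> i = j,
      (k <= 2)%N -> v ord_max <> v ord0,
      (3 <= k)%N -> forall i : 'I_k.+1, (1 <= i < k)%N -> v ord_max <> v i
    & forall i : 'I_k,
        a i \in A /\ (agrees_forward v a i \/ agrees_reverse v a i)].

Definition same_direction (V : finType) (k : nat)
    (v : 'I_k.+1 -> V) (a : 'I_k -> V * V) (i j : 'I_k) : Prop :=
  (agrees_forward v a i /\ agrees_forward v a j) \/
  (agrees_reverse v a i /\ agrees_reverse v a j).

Definition opposite_directions (V : finType) (k : nat)
    (v : 'I_k.+1 -> V) (a : 'I_k -> V * V) (i j : 'I_k) : Prop :=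
  (agrees_forward v a i /\ agrees_reverse v a j) \/
  (agrees_reverse v a i /\ agrees_forward v a j).

Definition connected_directly (V : finType) (a' a'' : V * V) : Prop :=
  exists u : V, u \in ends a' /\ u \in ends a''.

Definition connected_by_arc (V : finType) (A : {set V * V})
    (a' a'' : V * V) : Prop :=
  exists b : V * V, b \in A /\
    ((tail b \in ends a' /\ head b \in ends a'') \/
     (tail b \in ends a'' /\ head b \in ends a')).

Definition only_nontrivial_pairs (V : finType) (A Aa : {set V * V}) : Prop :=
  forall a' a'' : V * V, a' \in Aa -> a'' \in Aa -> a' != a'' ->
    ~ connected_directly a' a'' /\ ~ connected_by_arc A a' a''.

(* The right-hand side d of the system S(v1, v2). *)
Definition supply (R : realType) (V : finType) (v1 v2 : V) : 'cV[R]_#|V| :=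
  \col_i (if enum_val i == v1 then -1 else if enum_val i == v2 then 1 else 0).

Definition feasible (R : realType) (V : finType) (A : {set V * V})
    (a' a'' : V * V) (v1 v2 : V) : Prop :=
  exists y : 'cV[R]_#|A|,
    incidence R A *m y = supply R v1 v2 /\
    forall (j : 'I_#|A|) (u : V),
      u \in (ends a' :|: ends a'') :\: [set v1; v2] ->
      u \in ends (enum_val j) -> y j 0 = 0.

Definition npairs (V : finType) (Aa : {set V * V}) : nat :=
  ((#|Aa| * (#|Aa| - 1)) %/ 2)%N.

(* e lists the two-element subsets of Aa, each exactly once and in one of its
   two orders. *)
Definition enumerates_pairs (V : finType) (Aa : {set V * V})
    (e : (npairs Aa).-tuple ((V * V) * (V * V))) : Prop :=
  perm_eq [seq [set p.1; p.2] | p <- e]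
          (enum [set B : {set V * V} | (B \subset Aa) && (#|B| == 2)%N]).

Section DirectionChecking.

Variables (R : realType) (V : finType) (A Aa : {set V * V}).
Variable e : (npairs Aa).-tuple ((V * V) * (V * V)).

Definition eta_plus : 'rV[R]_(npairs Aa) :=
  \row_k (let: (a', a'') := tnth e k in
    `[< feasible R A a' a'' (head a') (tail a'') \/
        feasible R A a' a'' (head a'') (tail a') >]%:R).

Definition eta_minus : 'rV[R]_(npairs Aa) :=
  \row_k (let: (a', a'') := tnth e k in
    `[< feasible R A a' a'' (head a') (head a'') \/
        feasible R A a' a'' (tail a') (tail a'') >]%:R).

Definition eta : 'rV[R]_(npairs Aa) := eta_plus - eta_minus.

Definition eta_tilde : 'rV[R]_(npairs Aa) :=
  \row_k (eta_plus 0 k * eta_minus 0 k).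

(* The second test overrides the first: the output is -1 when eta = 0. *)
Definition direction_check : int :=
  if eta_tilde == 0 then
    let chi : int := if [forall k, 0 <= eta 0 k] then 1 else 0 in
    if [forall k, eta 0 k <= 0] then -1 else chi
  else 0.

End DirectionChecking.

(* Main.v *)
Require Import Defs.
From mathcomp Require Import all_boot all_order all_algebra.
From mathcomp Require Import boolp reals zify.

Set Implicit Arguments.
Unset Strict Implicit.
Unset Printing Implicit Defensive.

Import Order.TTheory GRing.Theory Num.Theory.

Local Open Scope ring_scope.

(** Let [i < j] be two positions of a path whose arcs are attackable. The part
    of the path strictly between them runs from [v (to i)] to [v (from j)];
    pushing one unit of flow along it solves S(v (to i), v (from j)), and the
    opposite flow solves the system with the two nodes exchanged
    ([path_feasible], [feasible_rev]). The side constraints hold since this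
    part of the path avoids the two outer ends [v (from i)] and [v (to j)]. As
    trivial pairs are excluded, the two inner nodes differ, which makes the
    right-hand side a genuine unit flow demand.

    Which ends of the two arcs are the inner nodes depends only on their
    directions in the path: if the directions agree, one inner node is a head
    and the other a tail, and otherwise they are two heads or two tails.
    Hence two arcs with the same direction force eta_plus = 1 at their pair
    ([same_direction_aligned]), and two arcs with opposite directions force
    eta_minus = 1 ([opposite_directions_opposed]).  An output of 1 or -1 says
    that eta_minus, respectively eta_plus, vanishes at every pair
    ([direction_check1], [direction_checkN1]), and every two distinct
    attackable arcs form one of the enumerated pairs, so that the wrong
    directions cannot occur. *)

(** * Unit flows along walks *)

Definition unit_at (R : realType) (V : finType) (u : V) : 'cV[R]_#|V| :=
  \col_i (enum_val i == u)%:R.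

Lemma incidence_delta (R : realType) (V : finType) (A : {set V * V})
    (j : 'I_#|A|) :
  incidence R A *m delta_mx j 0
  = unit_at R (Defs.head (enum_val j)) - unit_at R (tail (enum_val j)).
Proof. by rewrite -colE; apply/matrixP => i z; rewrite !mxE. Qed.

Lemma supplyE (R : realType) (V : finType) (x y : V) :
  x != y -> supply R x y = unit_at R y - unit_at R x.
Proof.
move=> neq_xy; apply/matrixP => i z; rewrite !mxE.
case: (eqVneq (enum_val i) x) => [->|_]; last by case: eqP; rewrite subr0.
by rewrite (negbTE neq_xy) sub0r.
Qed.

(** One unit sent along each arc of a walk, with a minus sign on the arcs that
    are traversed from head to tail: the contributions of consecutive arcs
    cancel at their common node.  Arcs may repeat, so the flow is built by
    induction instead of being given arc by arc. *)
Lemma walk_flow (R : realType) (V : finType) (A : {set V * V})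
    (w : nat -> V) (m n : nat) :
  (m <= n)%N ->
  (forall l, (m <= l < n)%N ->
     (w l, w l.+1) \in A \/ (w l.+1, w l) \in A) ->
  exists2 y : 'cV[R]_#|A|,
    incidence R A *m y = unit_at R (w n) - unit_at R (w m) &
    forall (j : 'I_#|A|) (u : V),
      (forall l, (m <= l <= n)%N -> w l != u) ->
      u \in ends (enum_val j) -> y j 0 = 0.
Proof.
move=> le_mn; rewrite -(subnKC le_mn); move: (n - m)%N => d {n le_mn}.
elim: d => [|d IHd] walkA.
  by exists 0 => [|j u _ _]; rewrite ?addn0 ?mulmx0 ?subrr // mxE.
have [l ltl|y yE y0] := IHd.
  by apply: walkA; rewrite addnS ltnS; case/andP: ltl => -> /ltnW ->.
rewrite addnS.
have avoid_delta (b : V * V) (bA : b \in A) (j : 'I_#|A|) (u : V) :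
    u \notin ends b -> u \in ends (enum_val j) ->
    (delta_mx (enum_rank_in bA b) 0 : 'cV[R]_#|A|) j 0 = 0.
  move=> uNb uj; rewrite mxE andbT; case: eqP => // jE.
  by move: uj uNb; rewrite jE enum_rankK_in // => ->.
have avoid_step u : (forall l, (m <= l <= (m + d).+1)%N -> w l != u) ->
    w (m + d)%N != u /\ w (m + d).+1 != u.
  by move=> wNu; split; apply: wNu; rewrite ?leqnSn ?leqnn ?leq_addr ?andbT //
    -addnS leq_addr.
have avoid_y (j : 'I_#|A|) u :
    (forall l, (m <= l <= (m + d).+1)%N -> w l != u) ->
    u \in ends (enum_val j) -> y j 0 = 0.
  move=> wNu; apply: y0 => l /andP[lem len]; apply: wNu.
  by rewrite lem leqW.
have [|bA|bA] := walkA (m + d)%N; first by rewrite leq_addr addnS ltnSn.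
- exists (y + delta_mx (enum_rank_in bA (w (m + d)%N, w (m + d).+1)) 0).
    rewrite mulmxDr yE incidence_delta enum_rankK_in // addrC.
    by rewrite addrA subrK.
  move=> j u wNu uj; have [Nu NSu] := avoid_step u wNu.
  rewrite mxE (avoid_y j u) // (avoid_delta _ bA j u) ?addr0 //.
  by rewrite !inE /= negb_or eq_sym Nu eq_sym NSu.
- exists (y - delta_mx (enum_rank_in bA (w (m + d).+1, w (m + d)%N)) 0).
    rewrite mulmxBr yE incidence_delta enum_rankK_in // opprB addrC.
    by rewrite addrA subrK.
  move=> j u wNu uj; have [Nu NSu] := avoid_step u wNu.
  rewrite mxE (avoid_y j u) // mxE (avoid_delta _ bA j u) ?subr0 //.
  by rewrite !inE /= negb_or eq_sym NSu eq_sym Nu.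
Qed.

(** * Feasibility between two arcs of a path *)

Lemma feasibleC (R : realType) (V : finType) (A : {set V * V})
    (a' a'' : V * V) (x y : V) :
  feasible R A a' a'' x y = feasible R A a'' a' x y.
Proof. by rewrite /feasible setUC. Qed.

(** Reversing the flow.  [x != y] matters: [supply x x] is -1 at [x], which is
    not its own opposite. *)
Lemma feasible_rev (R : realType) (V : finType) (A : {set V * V})
    (a' a'' : V * V) (x y : V) :
  x != y -> feasible R A a' a'' x y -> feasible R A a' a'' y x.
Proof.
move=> neq_xy [f [fE f0]]; exists (- f); split.
  by rewrite mulmxN fE !supplyE // ?opprB // eq_sym.
move=> j u; rewrite [[set y; x]]setUC => uV uj.
by rewrite mxE (f0 j u) // oppr0.
Qed.

Lemma arc_ends (V : finType) (k : nat) (v : 'I_k.+1 -> V) (a : 'I_k -> V * V)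
    (i : 'I_k) :
  agrees_forward v a i \/ agrees_reverse v a i ->
  ends (a i) = [set v (from i); v (to i)].
Proof. by case=> ->; rewrite /ends /tail /Defs.head //= setUC. Qed.

(** The flow along the part of the path between the two arcs is a solution as
    soon as this part avoids the outer ends of the arcs.  It does not start at
    node 0, and a closed path only repeats node 0, so its nodes differ from
    [v (from i)] and, for [k >= 3], from [v (to j)] even if that is the last
    node.  For [k <= 2] the two arcs would be consecutive, hence share a
    node. *)
Lemma path_feasible (R : realType) (V : finType) (A : {set V * V}) (k : nat)
    (v : 'I_k.+1 -> V) (a : 'I_k -> V * V) (i j : 'I_k) :
  is_path A v a -> (i < j)%N -> ~ connected_directly (a i) (a j) ->
  v (to i) != v (from j) /\
  feasible R A (a i) (a j) (v (to i)) (v (from j)).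
Proof.
move=> [k_gt0 v_inj v_last2 v_last3 arcs] lt_ij nconn.
have endsi := arc_ends (arcs i).2; have endsj := arc_ends (arcs j).2.
have neq_inner : v (to i) != v (from j).
  apply/eqP => vE; apply: nconn; exists (v (to i)).
  by rewrite endsi endsj !inE vE !eqxx orbT.
split=> //; pose w l := v (inord l).
have wE (l : 'I_k.+1) : w l = v l by rewrite /w inord_val.
have w_to (l : 'I_k) : w l.+1 = v (to l) by rewrite -wE /= /bump add1n.
have w_from (l : 'I_k) : w l = v (from l) by rewrite -wE.
have inord_ltE l : (l < k)%N -> (inord l : 'I_k.+1) = l :> nat.
  by move=> ltl; rewrite inordK // ltnS ltnW.
have w_inj l l' : (l < k)%N -> (l' < k)%N -> w l = w l' -> l = l'.
  move=> ltl ltl' /v_inj; rewrite !inord_ltE // => /(_ ltl ltl').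
  by move=> /(congr1 (@nat_of_ord _)); rewrite !inord_ltE.
have w_last l : (1 <= l < k)%N -> w k <> w l.
  move=> /andP[l_gt0 ltl] wkl.
  have [k_le2|k_gt2] := leqP k 2.
    (* Two consecutive arcs meet at [v (to i)]. *)
    have j1 : j = i.+1 :> nat.
      by have := ltn_ord j; move: lt_ij k_le2; lia.
    by case/eqP: neq_inner; rewrite -w_to -w_from j1.
  apply: (v_last3 k_gt2 (inord l)); first by rewrite inord_ltE ?l_gt0.
  by rewrite -[RHS]wkl -(wE ord_max).
have ltSij : (i.+1 <= j)%N by [].
have [l /andP[lel ltl]|y yE y0] := @walk_flow R V A w i.+1 j ltSij.
  have ltk : (l < k)%N := ltn_trans ltl (ltn_ord j).
  have := arcs (Ordinal ltk); rewrite /agrees_forward /agrees_reverse.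
  by rewrite -w_to -w_from /= => -[bA [bE|bE]]; [left|right]; rewrite -bE.
exists y; split; first by rewrite supplyE // yE w_to w_from.
move=> jj u uV; apply: y0 => l /andP[lel ltl].
have ltk : (l < k)%N := leq_ltn_trans ltl (ltn_ord j).
apply/eqP => wlu; move: uV; rewrite -{}wlu endsi endsj !inE negb_or.
case/andP=> /andP[Nto Nfrom].
rewrite (negbTE Nto) (negbTE Nfrom) orbF /=.
rewrite -w_from -w_to => /orP[]/eqP.
  by move/(w_inj _ _ ltk (ltn_ord i)) => lE; move: lel; rewrite lE ltnn.
have : (j.+1 <= k)%N := ltn_ord j.
rewrite leq_eqVlt => /orP[/eqP jk|ltjk] wE'.
  apply: (w_last l); last by rewrite wE' jk.
  by rewrite ltk andbT (leq_trans _ lel).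
by move/(w_inj _ _ ltk ltjk): wE' => lE; move: ltl; rewrite lE ltnn.
Qed.

(** Both senses of the unit flow between the inner nodes are recorded, for
    both orders of the pair, since the enumeration of the pairs may list the
    two arcs in the other order than the path. *)
Lemma path_pair_feasible (R : realType) (V : finType) (A : {set V * V})
    (k : nat) (v : 'I_k.+1 -> V) (a : 'I_k -> V * V) (i j : 'I_k)
    (p : (V * V) * (V * V)) :
  is_path A v a -> (i < j)%N -> ~ connected_directly (a i) (a j) ->
  p = (a i, a j) \/ p = (a j, a i) ->
  feasible R A p.1 p.2 (v (to i)) (v (from j)) /\
  feasible R A p.1 p.2 (v (from j)) (v (to i)).
Proof.
move=> Pva lt_ij nconn pE; have [neq f] := path_feasible R Pva lt_ij nconn.
by case: pE => ->; rewrite /= ?(feasibleC _ _ (a j)); split=> //;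
  apply: feasible_rev.
Qed.

(** * Directions in a path and the tests of the algorithm *)

Definition aligned (R : realType) (V : finType) (A : {set V * V})
    (p : (V * V) * (V * V)) : Prop :=
  feasible R A p.1 p.2 (Defs.head p.1) (tail p.2) \/
  feasible R A p.1 p.2 (Defs.head p.2) (tail p.1).

Definition opposed (R : realType) (V : finType) (A : {set V * V})
    (p : (V * V) * (V * V)) : Prop :=
  feasible R A p.1 p.2 (Defs.head p.1) (Defs.head p.2) \/
  feasible R A p.1 p.2 (tail p.1) (tail p.2).

Lemma same_direction_aligned (R : realType) (V : finType) (A : {set V * V})
    (k : nat) (v : 'I_k.+1 -> V) (a : 'I_k -> V * V) (i j : 'I_k)
    (p : (V * V) * (V * V)) :
  is_path A v a -> (i < j)%N -> ~ connected_directly (a i) (a j) ->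
  p = (a i, a j) \/ p = (a j, a i) ->
  same_direction v a i j -> aligned R A p.
Proof.
move=> Pva lt_ij nconn pE dir; have := path_pair_feasible R Pva lt_ij nconn pE.
rewrite /aligned; case: pE => ->; case: dir => -[-> ->];
  by rewrite /Defs.head /tail /= => -[f fr]; do [by left | by right].
Qed.

Lemma opposite_directions_opposed (R : realType) (V : finType)
    (A : {set V * V}) (k : nat) (v : 'I_k.+1 -> V) (a : 'I_k -> V * V)
    (i j : 'I_k) (p : (V * V) * (V * V)) :
  is_path A v a -> (i < j)%N -> ~ connected_directly (a i) (a j) ->
  p = (a i, a j) \/ p = (a j, a i) ->
  opposite_directions v a i j -> opposed R A p.
Proof.
move=> Pva lt_ij nconn pE dir; have := path_pair_feasible R Pva lt_ij nconn pE.
rewrite /opposed; case: pE => ->; case: dir => -[-> ->];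
  by rewrite /Defs.head /tail /= => -[f fr]; do [by left | by right].
Qed.

(** * The output of the algorithm *)

Lemma etaE (R : realType) (V : finType) (A Aa : {set V * V})
    (e : (npairs Aa).-tuple ((V * V) * (V * V))) (k : 'I_(npairs Aa)) :
  eta R A e 0 k
  = `[< aligned R A (tnth e k) >]%:R - `[< opposed R A (tnth e k) >]%:R.
Proof. by rewrite !mxE /aligned /opposed; case: (tnth e k). Qed.

Lemma eta_tildeE (R : realType) (V : finType) (A Aa : {set V * V})
    (e : (npairs Aa).-tuple ((V * V) * (V * V))) (k : 'I_(npairs Aa)) :
  eta_tilde R A e 0 k
  = `[< aligned R A (tnth e k) >]%:R * `[< opposed R A (tnth e k) >]%:R.
Proof. by rewrite !mxE /aligned /opposed; case: (tnth e k). Qed.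

(** A zero eta_tilde means that eta_plus and eta_minus are never both 1, so a
    nonnegative eta leaves no 1 in eta_minus. *)
Lemma direction_check1 (R : realType) (V : finType) (A Aa : {set V * V})
    (e : (npairs Aa).-tuple ((V * V) * (V * V))) :
  direction_check R A e = 1 -> forall p, p \in e -> ~ opposed R A p.
Proof.
rewrite /direction_check; case: eqP => // eta0; case: ifP => // _.
case: ifP => // /forallP eta_ge0 _ p /tnthP[k ->] opp.
move/matrixP/(_ 0 k): eta0; move: (eta_ge0 k).
rewrite eta_tildeE etaE (asboolT opp) mxE mulr1 => + eta_plus0.
by rewrite eta_plus0 sub0r oppr_ge0 ler10.
Qed.

Lemma direction_checkN1 (R : realType) (V : finType) (A Aa : {set V * V})
    (e : (npairs Aa).-tuple ((V * V) * (V * V))) :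
  direction_check R A e = -1 -> forall p, p \in e -> ~ aligned R A p.
Proof.
rewrite /direction_check; case: eqP => // eta0.
case: ifP => [/forallP eta_le0 _ p /tnthP[k ->] ali|_]; last by case: ifP.
move/matrixP/(_ 0 k): eta0; move: (eta_le0 k).
rewrite eta_tildeE etaE (asboolT ali) mxE mul1r => + eta_minus0.
by rewrite eta_minus0 subr0 ler10.
Qed.

Lemma enumerates_pairs_mem (V : finType) (Aa : {set V * V})
    (e : (npairs Aa).-tuple ((V * V) * (V * V))) (b c : V * V) :
  enumerates_pairs e -> b \in Aa -> c \in Aa -> b <> c ->
  exists2 p, p \in e & p = (b, c) \/ p = (c, b).
Proof.
move=> he bAa cAa /eqP neq_bc.
have : [set b; c] \in [seq [set p.1; p.2] | p <- e].
  rewrite (perm_mem he) mem_enum inE cards2 neq_bc eqxx andbT.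
  by rewrite subUset !sub1set bAa.
case/mapP=> -[b' c'] p_e /= bcE; exists (b', c') => //.
have : b \in [set b'; c'] by rewrite -bcE set21.
have : c \in [set b'; c'] by rewrite -bcE set22.
move=> /set2P[] cE /set2P[] bE; rewrite bE cE ?eqxx // in neq_bc *.
  by right.
by left.
Qed.

Theorem proposition9 (R : realType) (V : finType) (A Aa : {set V * V})
    (hAa : Aa \subset A)
    (hnt : only_nontrivial_pairs A Aa)
    (e : (npairs Aa).-tuple ((V * V) * (V * V)))
    (he : enumerates_pairs e) :
  (direction_check R A e = 1 ->
     forall (k : nat) (v : 'I_k.+1 -> V) (a : 'I_k -> V * V),
       is_path A v a ->
       forall i j : 'I_k, a i \in Aa -> a j \in Aa -> a i <> a j ->
         same_direction v a i j) /\
  (direction_check R A e = -1 ->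
     forall (k : nat) (v : 'I_k.+1 -> V) (a : 'I_k -> V * V),
       is_path A v a ->
       forall i j : 'I_k, a i \in Aa -> a j \in Aa -> a i <> a j ->
         opposite_directions v a i j).
Proof.
have main k (v : 'I_k.+1 -> V) (a : 'I_k -> V * V) (i j : 'I_k) :
    is_path A v a -> (i < j)%N -> a i \in Aa -> a j \in Aa -> a i <> a j ->
    (direction_check R A e = 1 -> same_direction v a i j) /\
    (direction_check R A e = -1 -> opposite_directions v a i j).
  move=> Pva lt_ij aiA ajA neq_a.
  have [nconn _] := hnt _ _ aiA ajA (introN eqP neq_a).
  have [p p_e pE] := enumerates_pairs_mem he aiA ajA neq_a.
  have same_or_opp : same_direction v a i j \/ opposite_directions v a i j.
    case: Pva => _ _ _ _ arcs; rewrite /same_direction /opposite_directions.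
    by have [_ diri] := arcs i; have [_ dirj] := arcs j; tauto.
  split=> chk; case: same_or_opp => // dir.
    case: (direction_check1 chk p_e).
    exact: opposite_directions_opposed Pva lt_ij nconn pE dir.
  case: (direction_checkN1 chk p_e).
  exact: same_direction_aligned Pva lt_ij nconn pE dir.
split=> chk k v a Pva i j aiA ajA neq_a.
all: have [lt_ij|lt_ji|/val_inj eq_ij] := ltngtP i j;
  last by rewrite eq_ij in neq_a.
- exact: (main _ _ _ _ _ Pva lt_ij aiA ajA neq_a).1.
- have := (main _ _ _ _ _ Pva lt_ji ajA aiA (nesym neq_a)).1 chk.
  by rewrite /same_direction; tauto.
- exact: (main _ _ _ _ _ Pva lt_ij aiA ajA neq_a).2.
- have := (main _ _ _ _ _ Pva lt_ji ajA aiA (nesym neq_a)).2 chk.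
  by rewrite /opposite_directions; tauto.
Qed.
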